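(* Let $m\ge6$ be even, $t=m/2$, and $s$ an integer with $2\le s\le 2^{t-1}-1$. Let $E_1,\dots,E_\alpha$ be a partial spread in $\mathbb{F}_2^m$ and $A,B\subseteq\{1,\dots,\alpha\}$ with $|A|=|B|=s$ and $|A\cap B|=1$. Let $f=\sum_{i\in A}f_i$ and $g=\sum_{i\in B}f_i$. Then $\mathcal{C}_{f,g}$ is a minimal binary linear code of length $2^m-1$ and dimension $m+2$, and the multiset of weights of its codewords is: $0$ once; $s(2^t-1)$ twice; $(2s-2)(2^t-1)$ once; $2^{m-1}$ with multiplicity $2^m-1$; $2^{m-1}-s$ with multiplicity $2(2^t+1-s)(2^t-1)$; $2^{m-1}-(2s-2)$ with multiplicity $(2^t+3-2s)(2^t-1)$; $2^{m-1}+2^t-s$ with multiplicity $2s(2^t-1)$; $2^{m-1}+2^t-(2s-2)$ with multiplicity $(2s-2)(2^t-1)$ (listed weights that coincide have their multiplicities added). Moreover, if in addition $s\le 2^{t-2}$, then $w_{\min}/w_{\max}\le 1/2$, where $w_{\min}$ and $w_{\max}$ are the minimum and maximum nonzero weights of $\mathcal{C}_{f,g}$.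
   Context: A partial spread in $\mathbb{F}_2^m$ ($m=2t$) is a set of subspaces $E_1,\dots,E_\alpha$ of $\mathbb{F}_2^m$, each of dimension $t$, with $E_i\cap E_j=\{\mathbf{0}\}$ for $i\ne j$. $f_i:\mathbb{F}_2^m\to\mathbb{F}_2$ is the indicator function of $E_i\setminus\{\mathbf{0}\}$; sums of Boolean functions are mod 2. $\mathcal{C}_{f,g}=\{(uf(\mathbf{x})+rg(\mathbf{x})+\mathbf{v}\cdot\mathbf{x})_{\mathbf{x}\in\mathbb{F}_2^m\setminus\{\mathbf{0}\}}: u,r\in\mathbb{F}_2,\ \mathbf{v}\in\mathbb{F}_2^m\}$ with the standard inner product. A binary linear code is minimal if no nonzero codeword $\mathbf{c}$ has a nonzero codeword $\mathbf{c}'\neq\mathbf{c}$ with $\mathrm{Supp}(\mathbf{c}')\subseteq\mathrm{Supp}(\mathbf{c})$, where $\mathrm{Supp}$ denotes the set of nonzero coordinate positions. *)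

(* Defs.v *)
From HB Require Import structures.
From mathcomp Require Import all_boot all_order all_algebra.
Set Implicit Arguments. Unset Strict Implicit. Unset Printing Implicit Defensive.
Import GRing.Theory.
Local Open Scope ring_scope.

Definition partial_spread (m t alpha : nat) (E : 'I_alpha -> {vspace 'rV['F_2]_m}) :=
  (forall i, \dim (E i) = t) /\
  (forall i j, i != j -> (E i :&: E j)%VS = 0%VS).

Definition spread_ind (m : nat) (Ei : {vspace 'rV['F_2]_m}) (x : 'rV['F_2]_m) : 'F_2 :=
  ((x \in Ei) && (x != 0))%:R.

Definition spread_sum m alpha (E : 'I_alpha -> {vspace 'rV['F_2]_m}) (A : {set 'I_alpha})
  (x : 'rV['F_2]_m) : 'F_2 := \sum_(i in A) spread_ind (E i) x.

Definition dotF2 m (v x : 'rV['F_2]_m) : 'F_2 := \sum_(k < m) v 0 k * x 0 k.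

(* Coordinate positions: the nonzero vectors of F_2^m, enumerated by enum_val. *)
Definition nzvec (m : nat) := {x : 'rV['F_2]_m | x != 0}.
Definition codelen (m : nat) : nat := #|{: nzvec m}|.
Definition pos_vec m (j : 'I_(codelen m)) : 'rV['F_2]_m := val (enum_val j).

Definition codeword m (f g : 'rV['F_2]_m -> 'F_2) (u r : 'F_2) (v : 'rV['F_2]_m)
  : 'rV['F_2]_(codelen m) :=
  \row_(j < codelen m) (u * f (pos_vec j) + r * g (pos_vec j) + dotF2 v (pos_vec j)).

Definition code_fg m (f g : 'rV['F_2]_m -> 'F_2) : {set 'rV['F_2]_(codelen m)} :=
  [set codeword f g p.1.1 p.1.2 p.2 | p : 'F_2 * 'F_2 * 'rV['F_2]_m].

Definition supp n (c : 'rV['F_2]_n) : {set 'I_n} := [set j | c 0 j != 0].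
Definition wt n (c : 'rV['F_2]_n) : nat := #|supp c|.

Definition is_linear_code n (C : {set 'rV['F_2]_n}) :=
  (0 \in C) /\ (forall c c', c \in C -> c' \in C -> c + c' \in C).

Definition code_dim n (C : {set 'rV['F_2]_n}) : nat := \dim <<enum C>>%VS.

Definition minimal_code n (C : {set 'rV['F_2]_n}) :=
  forall c c', c \in C -> c' \in C -> c != 0 -> c' != 0 ->
    supp c' \subset supp c -> c' = c.

Definition listed_mult (L : seq (nat * nat)) (w : nat) : nat :=
  \sum_(p <- L) (if p.1 == w then p.2 else 0)%N.

(* Main.v *)
(* Write T = 2^t and N = 2^(m-1). A codeword is the vector of values of
   h_D(x) + v.x, where h_D is the indicator of the union of the E_i \ {0} with
   i in D, and D is empty, A, B or the symmetric difference of A and B. Since v.x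
   vanishes on E_i or is balanced there, the weight is #|D| (T - 1) for v = 0 and
   N - #|D| + e T otherwise, with e = 1 if v is orthogonal to some E_i (i in D) and
   e = 0 if not. The orthogonals of the E_i have T elements and again intersect
   pairwise trivially, which gives the multiplicities. If Supp c' is contained in
   Supp c, then wt c = wt c' + wt (c + c'), and no two nonzero weights can add up in
   this way. *)
Require Import Defs.
From mathcomp Require Import all_boot all_order all_algebra.
From mathcomp Require Import finfield zify.
Set Implicit Arguments.
Unset Strict Implicit.
Unset Printing Implicit Defensive.
Import GRing.Theory.
Local Open Scope ring_scope.

(** * Arithmetic in ['F_2] and the dot product *)

Lemma F2P (a : 'F_2) : a = 0 \/ a = 1.
Proof. by case: a => [[|[|i]] ia] //; [left | right]; apply/val_inj. Qed.

Lemma F2_neq0D (a b : 'F_2) : (a + b != 0) = (a != 0) (+) (b != 0).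
Proof. by case: (F2P a) => ->; case: (F2P b) => ->. Qed.

Lemma F2_neq0_inj (a b : 'F_2) : (a != 0) = (b != 0) -> a = b.
Proof. by case: (F2P a) => ->; case: (F2P b) => ->. Qed.

Lemma rowF2_addK n (x : 'rV['F_2]_n) : x + x = 0.
Proof.
by apply/rowP=> i; rewrite !mxE; apply/F2_neq0_inj; rewrite F2_neq0D addbb.
Qed.

Lemma dotF2C m (v x : 'rV['F_2]_m) : dotF2 v x = dotF2 x v.
Proof. by apply: eq_bigr => k _; rewrite mulrC. Qed.

Lemma dotF2Dr m (v x y : 'rV['F_2]_m) : dotF2 v (x + y) = dotF2 v x + dotF2 v y.
Proof. by rewrite -big_split; apply: eq_bigr => k _; rewrite mxE mulrDr. Qed.

Lemma dotF2Dl m (v w x : 'rV['F_2]_m) : dotF2 (v + w) x = dotF2 v x + dotF2 w x.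
Proof. by rewrite dotF2C dotF2Dr !(dotF2C x). Qed.

Lemma dotF20 m (v : 'rV['F_2]_m) : dotF2 v 0 = 0.
Proof. by apply: big1 => k _; rewrite mxE mulr0. Qed.

Lemma dot0F2 m (v : 'rV['F_2]_m) : dotF2 0 v = 0.
Proof. by rewrite dotF2C dotF20. Qed.

(** * Orthogonality to a subspace *)

Definition orthv m (U : {vspace 'rV['F_2]_m}) (v : 'rV['F_2]_m) : bool :=
  [forall x in U, dotF2 v x == 0].

Lemma orthv0 m (U : {vspace 'rV['F_2]_m}) : orthv U 0.
Proof. by apply/forall_inP=> x _; rewrite dot0F2. Qed.

Lemma orthvD m (U V : {vspace 'rV['F_2]_m}) v :
  orthv U v -> orthv V v -> orthv (U + V) v.
Proof.
move=> /forall_inP Uv /forall_inP Vv; apply/forall_inP=> _ /memv_addP[x Ux [y Vy ->]].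
by rewrite dotF2Dr (eqP (Uv _ Ux)) (eqP (Vv _ Vy)) addr0.
Qed.

Lemma orthv_fullv m (v : 'rV['F_2]_m) : orthv fullv v = (v == 0).
Proof.
apply/idP/eqP=> [/forall_inP v0|->]; last exact: orthv0.
apply/rowP=> i; move/eqP: (v0 (delta_mx 0 i) (memvf _)).
rewrite /dotF2 (bigD1 i) //= big1 => [|k /negPf ki]; rewrite !mxE ?ki ?andbF ?mulr0 //.
by rewrite !eqxx mulr1 addr0.
Qed.

Lemma card_vspaceF2 m (U : {vspace 'rV['F_2]_m}) : #|U| = (2 ^ \dim U)%N.
Proof. by rewrite card_vspace card_ord. Qed.

Lemma card_rowF2 m : #|{: 'rV['F_2]_m}| = (2 ^ m)%N.
Proof. by rewrite card_mx card_ord mul1n. Qed.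

(* If some x0 in U has v.x0 = 1, translation by x0 exchanges the zeros and the
   ones of x |-> v.x on U. *)
Lemma card_dotF2_neq0 m (U : {vspace 'rV['F_2]_m}) v :
  (2 * \sum_(x in U) (dotF2 v x != 0)%R = (~~ orthv U v) * 2 ^ \dim U)%N.
Proof.
case: (boolP (orthv U v)) => [/forall_inP Uv|].
  by rewrite big1 ?mul0n ?muln0 // => x Ux; rewrite Uv.
rewrite negb_forall_in mul1n => /exists_inP[x0 Ux0 vx0].
rewrite -card_vspaceF2 -sum1_card mul2n -addnn.
rewrite [in X in (X + _)%N](reindex_inj (addIr x0)) /=.
rewrite (eq_bigl (mem U)) => [|x]; last by rewrite /= rpredDr.
rewrite -big_split; apply: eq_bigr => x _ /=.
by rewrite dotF2Dr F2_neq0D vx0; case: (_ != 0).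
Qed.

Lemma dim_rowF2 m : \dim (fullv : {vspace 'rV['F_2]_m}) = m.
Proof. by rewrite dimvf; apply: mul1n. Qed.

(* Double counting of the pairs (v, x) with x in U and v.x = 1. *)
Lemma card_orthv m (U : {vspace 'rV['F_2]_m}) :
  (\sum_(v : 'rV['F_2]_m) orthv U v * 2 ^ \dim U = 2 ^ m)%N.
Proof.
set T := (2 ^ \dim U)%N.
have TE : (\sum_(x in U) 1 = T)%N by rewrite sum1_card card_vspaceF2.
(* A nonzero [x] in [U] has [v.x = 1] for half of all [v]; the added [2 ^ m] makes up for [x = 0],
   which occurs in no pair. *)
have H : (\sum_(v : 'rV['F_2]_m) (~~ orthv U v) * T + 2 ^ m = T * 2 ^ m)%N.
  under eq_bigr => v _ do rewrite -card_dotF2_neq0.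
  rewrite -big_distrr exchange_big big_distrr /=.
  rewrite -TE big_distrl (bigD1 0%R) ?mem0v //= [in RHS](bigD1 0%R) ?mem0v //=.
  rewrite big1 ?muln0 ?add0n ?mul1n => [|v _]; last by rewrite dotF20.
  rewrite addnC; congr (_ + _)%N; apply: eq_bigr => x /andP[_ x0].
  (* The roles are swapped: [x] is now the linear form and [v] runs over the whole space. *)
  have := card_dotF2_neq0 fullv x; rewrite orthv_fullv x0 dim_rowF2 mul1n => <-.
  congr (2 * _)%N; apply: eq_big => [v|v _]; first by rewrite memvf.
  by rewrite dotF2C.
apply/eqP; rewrite -(eqn_add2l (\sum_(v : 'rV['F_2]_m) (~~ orthv U v) * T)); apply/eqP.
rewrite H -big_split /= mulnC -card_rowF2 -sum1_card big_distrl /=.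
by apply: eq_bigr => v _; case: orthv; rewrite ?mul0n ?addn0 ?mul1n.
Qed.

(** * Spread indicators and the weights of their sums with linear forms *)

Lemma spread_sum0 m alpha (E : 'I_alpha -> {vspace 'rV['F_2]_m}) (D : {set 'I_alpha}) :
  spread_sum E D 0 = 0.
Proof. by apply: big1 => i _; rewrite /spread_ind eqxx andbF. Qed.

(** A nonzero [x] lies in at most one [E i], so the sum mod 2 has at most one nonzero term and
    agrees with the sum of naturals. *)
Lemma sum_spread_neq0 m t alpha (E : 'I_alpha -> {vspace 'rV['F_2]_m}) (D : {set 'I_alpha}) x :
  partial_spread t E ->
  ((spread_sum E D x != 0)%R = \sum_(i in D) ((x \in E i) && (x != 0)%R) :> nat)%N.
Proof.
case=> _ Edisj; rewrite /spread_sum.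
case: (pickP (fun i => (i \in D) && ((x \in E i) && (x != 0)))) => [i|none].
  case/and3P=> Di Ex x0; rewrite !(bigD1 i Di) /= /spread_ind Ex x0 /=.
  rewrite !big1 => [|j /andP[_ ji]|j /andP[_ ji]] //; case: (boolP (x \in E j)) => // Exj;
    by have := Edisj _ _ ji; move/vspaceP/(_ x); rewrite memv_cap Ex Exj memv0 (negPf x0).
by rewrite !big1 => [|j Dj|j Dj] //; rewrite /spread_ind; have := none j; rewrite Dj /= => ->.
Qed.

(** The sum of [E i] and [E j] is direct of dimension [2 * t = m], hence the whole space. *)
Lemma partial_spread_orthv m t alpha (E : 'I_alpha -> {vspace 'rV['F_2]_m}) i j v :
  m = (2 * t)%N -> partial_spread t E -> i != j -> orthv (E i) v -> orthv (E j) v ->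
  v = 0.
Proof.
move=> mt [Edim Edisj] ij iv jv; apply/eqP; rewrite -orthv_fullv.
suff <- : (E i + E j)%VS = fullv by exact: orthvD.
apply/eqP; rewrite eqEdim subvf dim_rowF2 dimv_disjoint_sum ?Edisj // !Edim.
lia.
Qed.

(** By [partial_spread_orthv] at most one term is 1. *)
Lemma sum_orthv m t alpha (E : 'I_alpha -> {vspace 'rV['F_2]_m}) (D : {set 'I_alpha}) v :
  m = (2 * t)%N -> partial_spread t E -> v != 0 ->
  (\sum_(i in D) orthv (E i) v = [exists i in D, orthv (E i) v] :> nat)%N.
Proof.
move=> mt spE v0; case: (boolP [exists i in D, _]) => [/exists_inP[i Di iv]|].
  rewrite (bigD1 i) //= iv big1 // => j /andP[_ ji].
  apply/eqP; rewrite eqb0; apply: contra v0 => jv; apply/eqP.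
  exact: partial_spread_orthv mt spE ji jv iv.
by rewrite negb_exists_in => /forall_inP none; rewrite big1 // => i /none/negPf ->.
Qed.

Lemma card_orthv_spread m t alpha (E : 'I_alpha -> {vspace 'rV['F_2]_m}) i :
  m = (2 * t)%N -> partial_spread t E ->
  (\sum_(v : 'rV['F_2]_m | v != 0%R) orthv (E i) v = 2 ^ t - 1)%N.
Proof.
move=> mt [Edim _]; have := card_orthv (E i).
have -> : (2 ^ m = 2 ^ t * 2 ^ t)%N by rewrite mt mul2n -addnn expnD.
rewrite -big_distrl /= Edim => /eqP.
rewrite eqn_pmul2r ?expn_gt0 // (bigD1 0%R) //= orthv0 => /eqP <-.
by rewrite addnC addnK.
Qed.

Definition spread_fun m alpha (E : 'I_alpha -> {vspace 'rV['F_2]_m})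
    (D : {set 'I_alpha}) v x : 'F_2 :=
  spread_sum E D x + dotF2 v x.

Definition weight m (h : 'rV['F_2]_m -> 'F_2) : nat := #|[set x | h x != 0]|.

(* In the integers, wt(a + b) = wt(a) + wt(b) - 2 wt(ab); here a is the sum of
   spread indicators and b the linear form. *)
Lemma weight_spread_fun m t alpha (E : 'I_alpha -> {vspace 'rV['F_2]_m}) (D : {set 'I_alpha}) v :
  m = (2 * t)%N -> (0 < t)%N -> partial_spread t E ->
  (weight (spread_fun E D v) + #|D| =
   if v == 0%R then #|D| * 2 ^ t
   else 2 ^ (m - 1) + [exists i in D, orthv (E i) v] * 2 ^ t)%N.
Proof.
move=> mt t0 spE; have [Edim _] := spE.
have card_Ei i : (\sum_x ((x \in E i) && (x != 0)%R) + 1 = 2 ^ t)%N.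
  rewrite -(Edim i) -card_vspaceF2 -sum1_card [RHS](bigD1 0%R) ?mem0v //= addnC.
  congr (_ + _)%N; rewrite big_mkcond [RHS]big_mkcond; apply: eq_bigr => x _.
  by case: ifP.
have lin : (2 * \sum_x (dotF2 v x != 0)%R = (v != 0%R) * 2 ^ m)%N.
  have := card_dotF2_neq0 fullv v; rewrite dim_rowF2 orthv_fullv => <-; congr (2 * _)%N.
  by apply: eq_bigl => x; rewrite memvf.
(* This is twice the weight of the product: the support of the spread sum splits into the sets [E i]
   without 0, and a non-orthogonal [v] equals 1 on half of [E i]. *)
have prod : (2 * \sum_x (spread_sum E D x != 0)%R * (dotF2 v x != 0)%R =
             \sum_(i in D) (~~ orthv (E i) v) * 2 ^ t)%N.
  under eq_bigr => x _ do rewrite (sum_spread_neq0 _ _ spE) big_distrl.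
  rewrite exchange_big big_distrr /=; apply: eq_bigr => i _.
  have := card_dotF2_neq0 (E i) v; rewrite Edim => <-; congr (2 * _)%N.
  rewrite [RHS]big_mkcond.
  apply: eq_bigr => x _; case: (x \in E i) => //=.
  by case: eqP => [->|_]; rewrite ?dotF20 ?mul1n.
have W : (weight (spread_fun E D v) + \sum_(i in D) (~~ orthv (E i) v) * 2 ^ t =
   \sum_(i in D) \sum_x ((x \in E i) && (x != 0)%R) + \sum_x (dotF2 v x != 0)%R)%N.
  rewrite -prod exchange_big -big_split big_distrr /weight -sum1_card big_mkcond /=.
  rewrite -big_split; apply: eq_bigr => x _ /=.
  rewrite inE /spread_fun F2_neq0D -(sum_spread_neq0 _ _ spE).
  by case: (_ != 0); case: (_ != 0).
have kT : (#|D| * 2 ^ t = \sum_(i in D) \sum_x ((x \in E i) && (x != 0)%R) + #|D|)%N.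
  rewrite -sum1_card -big_split big_distrl; apply: eq_bigr => i _.
  by rewrite /= mul1n card_Ei.
case: eqP => [v0|/eqP v0].
  move: W lin; rewrite v0 eqxx mul0n big1 => [|i _]; last by rewrite orthv0.
  by rewrite kT; lia.
move: lin; rewrite v0 mul1n -(sum_orthv _ mt spE v0) => lin.
have -> : (2 ^ (m - 1) = \sum_x (dotF2 v x != 0)%R)%N.
  apply/eqP; rewrite -(@eqn_pmul2l 2) // lin -expnS; apply/eqP; congr (2 ^ _)%N; lia.
have : (\sum_(i in D) (~~ orthv (E i) v) * 2 ^ t +
        (\sum_(i in D) orthv (E i) v) * 2 ^ t = #|D| * 2 ^ t)%N.
  rewrite -sum1_card !big_distrl -big_split; apply: eq_bigr => i _ /=.
  by case: orthv; rewrite ?mul0n ?addn0.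
lia.
Qed.

(** The three terms come from [v = 0], from [v] orthogonal to no [E i] with [i] in [D], and from
    nonzero [v] orthogonal to one. The bound on [#|D|] keeps the natural subtractions exact. *)
Lemma card_weight_spread_fun m t alpha (E : 'I_alpha -> {vspace 'rV['F_2]_m})
    (D : {set 'I_alpha}) w :
  m = (2 * t)%N -> (0 < t)%N -> partial_spread t E -> (#|D| <= 2 ^ t)%N ->
  (\sum_v (weight (spread_fun E D v) == w) =
   (#|D| * (2 ^ t - 1) == w)
   + (2 ^ t + 1 - #|D|) * (2 ^ t - 1) * (2 ^ (m - 1) - #|D| == w)
   + #|D| * (2 ^ t - 1) * (2 ^ (m - 1) + 2 ^ t - #|D| == w))%N.
Proof.
move=> mt t0 spE kT; rewrite (bigD1 0%R) //= -addnA; congr (_ + _)%N.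
  have := weight_spread_fun D 0 mt t0 spE; rewrite eqxx mulnBr muln1.
  by move=> <-; rewrite addnK.
have orthN : (\sum_(v : 'rV['F_2]_m | v != 0%R) [exists i in D, orthv (E i) v]
              = #|D| * (2 ^ t - 1))%N.
  under eq_bigr => v v0 do rewrite -(sum_orthv _ mt spE v0).
  rewrite exchange_big -sum1_card big_distrl; apply: eq_bigr => i _ /=.
  by rewrite mul1n (card_orthv_spread _ mt spE).
(* Complement among the nonzero vectors, whose number factors as [(2 ^ t + 1) * (2 ^ t - 1)]. *)
have northN : (\sum_(v : 'rV['F_2]_m | v != 0%R) ~~ [exists i in D, orthv (E i) v]
              = (2 ^ t + 1 - #|D|) * (2 ^ t - 1))%N.
  apply/eqP; rewrite -(eqn_add2r (#|D| * (2 ^ t - 1))) -{1}orthN -big_split /=.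
  rewrite (eq_bigr (fun=> 1%N)) => [|v _]; last by case: [exists _ in _, _].
  have := card_rowF2 m; rewrite -sum1_card (bigD1 0%R) //=.
  have -> : (2 ^ m = 2 ^ t * 2 ^ t)%N by rewrite mt mul2n -addnn expnD.
  set S := \sum_(v | _) _; move: kT; set T := (2 ^ t)%N; set k := #|D|; nia.
rewrite -orthN -northN !big_distrl -big_split /=; apply: eq_bigr => v v0.
have := weight_spread_fun D v mt t0 spE; rewrite (negPf v0).
have : (2 ^ t <= 2 ^ (m - 1))%N by rewrite leq_exp2l //; lia.
case: [exists _ in _, _]; rewrite /= ?mul1n ?mul0n ?addn0 ?add0n => TN WE.
  by congr (nat_of_bool (_ == _)); lia.
by congr (nat_of_bool (_ == _)); lia.
Qed.

(** * Index sets of the combinations of [f] and [g] *)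

Definition comb_set alpha (A B : {set 'I_alpha}) (u r : 'F_2) : {set 'I_alpha} :=
  [set i | ((u != 0) && (i \in A)) (+) ((r != 0) && (i \in B))].

Lemma spread_sum_comb m alpha (E : 'I_alpha -> {vspace 'rV['F_2]_m}) A B u r x :
  u * spread_sum E A x + r * spread_sum E B x = spread_sum E (comb_set A B u r) x.
Proof.
rewrite /spread_sum !big_distrr /= !(big_mkcond (fun i => i \in _)) -big_split /=.
apply: eq_bigr => i _; apply: F2_neq0_inj; rewrite inE F2_neq0D.
case: (F2P u) => ->; case: (F2P r) => ->; case: (i \in A); case: (i \in B);
  by rewrite ?mul0r ?mul1r /= ?addbb ?addbF.
Qed.

(** Indices common to [A] and [B] cancel when both coefficients are 1; the additive form avoids
    truncated subtraction. *)
Lemma card_comb_set alpha (A B : {set 'I_alpha}) u r :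
  (#|comb_set A B u r| + 2 * ((u != 0)%R && (r != 0)%R) * #|A :&: B| =
   (u != 0)%R * #|A| + (r != 0)%R * #|B|)%N.
Proof.
rewrite -!sum1_card !big_distrr !(big_mkcond (fun i => i \in _)) -!big_split /=.
apply: eq_bigr => i _; rewrite !inE.
by case: (u != 0); case: (r != 0); case: (i \in A); case: (i \in B).
Qed.

(** * Codewords, supports and dimension *)

Lemma pos_vec_inj m : injective (@pos_vec m).
Proof. by move=> i j /val_inj/enum_val_inj. Qed.

(** Leaving out the coordinate 0 loses no weight, since the function vanishes there. *)
Lemma wt_codeword m (f g : 'rV['F_2]_m -> 'F_2) u r v : f 0 = 0 -> g 0 = 0 ->
  wt (codeword f g u r v) = weight (fun x => u * f x + r * g x + dotF2 v x).
Proof.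
move=> f0 g0; rewrite /wt -(card_imset _ (@pos_vec_inj m)); apply: eq_card => x.
rewrite inE; apply/imsetP/idP => [[j]|hx]; first by rewrite inE mxE => ? ->.
have x0 : x != 0 by apply: contraNneq hx => ->; rewrite f0 g0 dotF20 !mulr0 !addr0.
exists (enum_rank (Sub x x0 : nzvec m)); last by rewrite /pos_vec enum_rankK.
by rewrite inE mxE /pos_vec enum_rankK.
Qed.

Lemma codewordD m (f g : 'rV['F_2]_m -> 'F_2) (u r u' r' : 'F_2) (v v' : 'rV_m) :
  codeword f g (u + u') (r + r') (v + v') = codeword f g u r v + codeword f g u' r' v'.
Proof.
by apply/rowP=> j; rewrite !mxE dotF2Dl !mulrDl [X in X + _]addrACA; apply: addrACA.
Qed.

Lemma codeword0 m (f g : 'rV['F_2]_m -> 'F_2) : codeword f g 0 0 0 = 0.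
Proof. by apply/rowP=> j; rewrite !mxE dot0F2 !mul0r !addr0. Qed.

Lemma code_fg_linear m (f g : 'rV['F_2]_m -> 'F_2) : is_linear_code (code_fg f g).
Proof.
split; first by apply/imsetP; exists (0, 0, 0); rewrite //= codeword0.
move=> _ _ /imsetP[[[u r] v] _ ->] /imsetP[[[u' r'] v'] _ ->].
by apply/imsetP; exists (u + u', r + r', v + v'); rewrite //= codewordD.
Qed.

Lemma codelenE m : codelen m = (2 ^ m - 1)%N.
Proof.
by rewrite /codelen card_sig -card_rowF2 subn1 -(cardC1 (0 : 'rV['F_2]_m)); apply: eq_card.
Qed.

Lemma wt_eq0 n (c : 'rV['F_2]_n) : (wt c == 0%N) = (c == 0).
Proof.
rewrite cards_eq0; apply/eqP/eqP => [c0|->]; last by apply/setP=> j; rewrite !inE mxE eqxx.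
by apply/rowP=> j; apply/eqP; have := in_set0 j; rewrite -c0 inE mxE => /negbFE.
Qed.

(** The support of [c + c'] is the complement of [supp c'] in [supp c]. *)
Lemma wt_addK n (c c' : 'rV['F_2]_n) : supp c' \subset supp c ->
  wt c = (wt c' + wt (c + c'))%N.
Proof.
move=> cc; rewrite /wt -(cardsID (supp c') (supp c)) (setIidPr cc); congr (_ + _)%N.
apply: eq_card => j; have := subsetP cc j; rewrite !inE mxE F2_neq0D.
by case: (c 0 j != 0); case: (c' 0 j != 0) => // /(_ isT).
Qed.

(** The only scalars are 0 and 1, so [C] is its own span. The dimension can thus be read off from a
    count. *)
Lemma card_linear_code n (C : {set 'rV['F_2]_n}) :
  is_linear_code C -> #|C| = (2 ^ code_dim C)%N.
Proof.
move=> [C0 CD]; rewrite /code_dim -card_vspaceF2; apply: eq_card => c.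
apply/idP/idP => [cC|]; first by rewrite memv_span // mem_enum.
rewrite span_def big_enum /= => /memv_sumP[a aC ->]; elim/big_ind: _ => // c' c'C.
have /vlineP[k ->] := aC _ c'C.
by case: (F2P k) => ->; rewrite ?scale0r ?scale1r.
Qed.

(** Arithmetic core of minimality, for words 1, 2 and their sum 3: [u], [r] tell which coefficients
    are nonzero, [k] is the size of the index set, [z] says that [v = 0], and [e] that [v] is
    orthogonal to some [E i]. *)
Lemma spread_weight_not_sum (T N s : nat) (u1 r1 u2 r2 z1 z2 z3 e1 e2 e3 : bool)
    (k1 k2 k3 w1 w2 w3 : nat) :
  (8 <= T -> T * T = 2 * N -> 2 <= s -> 2 * s + 2 <= T ->
  k1 + 2 * (u1 && r1) = u1 * s + r1 * s ->
  k2 + 2 * (u2 && r2) = u2 * s + r2 * s ->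
  k3 + 2 * ((u1 (+) u2) && (r1 (+) r2)) = (u1 (+) u2) * s + (r1 (+) r2) * s ->
  w1 + k1 = (if z1 then k1 * T else N + e1 * T) ->
  w2 + k2 = (if z2 then k2 * T else N + e2 * T) ->
  w3 + k3 = (if z3 then k3 * T else N + e3 * T) ->
  (z1 -> z2 = z3) -> (z2 -> z1 = z3) -> (z3 -> z1 = z2) ->
  0 < w1 -> 0 < w2 -> w3 <> w1 + w2)%N.
Proof.
move=> T8 TN s2 sT K1 K2 K3.
(* [lia] sees [s * T] and [T * T] as atoms; [S1] to [S4] and [L] provide the nonlinear facts about
   them. *)
have S1 : (2 * (s * T) + 2 * T <= T * T)%N.
  by rewrite mulnA -mulnDl leq_mul2r sT orbT.
have S2 : (8 * T <= T * T)%N by rewrite leq_mul2r T8 orbT.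
have S3 : (2 * T <= s * T)%N by rewrite leq_mul2r s2 orbT.
have S4 : (s * 8 <= s * T)%N by rewrite leq_mul2l T8 orbT.
have L k u r : (k + 2 * (u && r) = u * s + r * s ->
    k * T + 2 * (u && r) * T = u * (s * T) + r * (s * T))%N.
  by move=> h; rewrite -mulnDl h mulnDl !mulnA.
move: (L _ _ _ K1) (L _ _ _ K2) (L _ _ _ K3).
move: K1 K2 K3.
case: u1; case: r1; case: u2; case: r2 => /= K1 K2 K3 L1 L2 L3;
  case: z1; case: z2; case: z3 => // W1 W2 W3 Z1 Z2 Z3 w1P w2P;
  (* Exactly two of the three vectors cannot vanish. *)
  try (by move: (Z1 isT)); try (by move: (Z2 isT)); try (by move: (Z3 isT));
  case: e1 W1; case: e2 W2; case: e3 W3; lia.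
Qed.

(** * Counting codewords through their parameters *)

Lemma sum_F2 (F : 'F_2 -> nat) : (\sum_u F u = F 0%R + F 1%R)%N.
Proof.
rewrite !big_ord_recl big_ord0 addn0; congr (F _ + F _)%N; exact: val_inj.
Qed.

Lemma listed_multE L w : (listed_mult L w = \sum_(p <- L) p.2 * (p.1 == w))%N.
Proof. by apply: eq_bigr => p _; case: eqP; rewrite ?muln1 ?muln0. Qed.

(** In characteristic 2 the sum of two triples with equal codewords lies in the kernel, and a zero
    sum means equality. *)
Lemma codeword_inj m (f g : 'rV['F_2]_m -> 'F_2) :
  (forall u r v, codeword f g u r v = 0 -> [/\ u = 0, r = 0 & v = 0]) ->
  injective (fun p : 'F_2 * 'F_2 * 'rV_m => codeword f g p.1.1 p.1.2 p.2).
Proof.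
move=> ker [[u r] v] [[u' r'] v'] /= eqc.
have [] : [/\ u + u' = 0, r + r' = 0 & v + v' = 0].
  by apply: ker; rewrite codewordD eqc rowF2_addK.
have F2I (a b : 'F_2) : a + b = 0 -> a = b by case: (F2P a) => ->; case: (F2P b) => ->.
by move=> /F2I -> /F2I ->; rewrite -(rowF2_addK v') => /addIr ->.
Qed.

Lemma card_wt_code_fg m (f g : 'rV['F_2]_m -> 'F_2) w :
  injective (fun p : 'F_2 * 'F_2 * 'rV_m => codeword f g p.1.1 p.1.2 p.2) ->
  #|[set c in code_fg f g | wt c == w]| =
  (\sum_u \sum_r \sum_v (wt (codeword f g u r v) == w))%N.
Proof.
move=> cw_inj; rewrite !pair_bigA /=.
transitivity #|[set p : 'F_2 * 'F_2 * 'rV_m | wt (codeword f g p.1.1 p.1.2 p.2) == w]|.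
  rewrite -(card_imset _ cw_inj); apply: eq_card => c; rewrite inE.
  apply/andP/imsetP => [[/imsetP[p _ ->] wp]|[p]]; first by exists p; rewrite ?inE.
  by rewrite inE => wp ->; split=> //; apply: imset_f.
by rewrite -sum1_card big_mkcond; apply: eq_bigr => p _; rewrite inE; case: eqP.
Qed.

Unset Implicit Arguments.

Theorem theorem8 (m t s alpha : nat) (E : 'I_alpha -> {vspace 'rV['F_2]_m})
  (A B : {set 'I_alpha}) :
  (6 <= m)%N -> m = (2 * t)%N ->
  (2 <= s)%N -> (s <= 2 ^ (t - 1) - 1)%N ->
  partial_spread t E ->
  #|A| = s -> #|B| = s -> #|A :&: B| = 1%N ->
  let f := spread_sum E A in
  let g := spread_sum E B in
  let C := code_fg f g in
  [/\ [/\ is_linear_code C, codelen m = (2 ^ m - 1)%N & code_dim C = (m + 2)%N],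
      minimal_code C,
      (forall w : nat,
         #|[set c in C | wt c == w]| =
         listed_mult
           [:: (0, 1);
               (s * (2 ^ t - 1), 2);
               ((2 * s - 2) * (2 ^ t - 1), 1);
               (2 ^ (m - 1), 2 ^ m - 1);
               (2 ^ (m - 1) - s, 2 * (2 ^ t + 1 - s) * (2 ^ t - 1));
               (2 ^ (m - 1) - (2 * s - 2), (2 ^ t + 3 - 2 * s) * (2 ^ t - 1));
               (2 ^ (m - 1) + 2 ^ t - s, 2 * s * (2 ^ t - 1));
               (2 ^ (m - 1) + 2 ^ t - (2 * s - 2), (2 * s - 2) * (2 ^ t - 1))]%N
           w)
    & ((s <= 2 ^ (t - 2))%N ->
       exists cmin cmax,
         [/\ cmin \in C /\ cmin != 0, cmax \in C /\ cmax != 0,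
             (forall c, c \in C -> c != 0 -> (wt cmin <= wt c <= wt cmax)%N)
           & (2 * wt cmin <= wt cmax)%N])].
Proof.
move=> m6 mt s2 sT spE cA cB cAB f g C.
have t3 : (3 <= t)%N by lia.
have T8 : (8 <= 2 ^ t)%N by rewrite -[8%N]/(2 ^ 3)%N leq_exp2l.
have mT : (2 ^ m = 2 ^ t * 2 ^ t)%N by rewrite mt mul2n -addnn expnD.
have m2 : (2 ^ m = 2 * 2 ^ (m - 1))%N by rewrite -expnS; congr (2 ^ _)%N; lia.
have T2 : (2 ^ t = 2 * 2 ^ (t - 1))%N by rewrite -expnS; congr (2 ^ _)%N; lia.
have sT2 : (2 * s + 2 <= 2 ^ t)%N by lia.
have wtE u r v : wt (codeword f g u r v) = weight (spread_fun E (comb_set A B u r) v).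
  rewrite (wt_codeword _ _ _ (spread_sum0 E A) (spread_sum0 E B)) /weight.
  by apply: eq_card => x; rewrite !inE spread_sum_comb.
have kE u r : (#|comb_set A B u r| + 2 * ((u != 0)%R && (r != 0)%R) =
               (u != 0)%R * s + (r != 0)%R * s)%N.
  by have := card_comb_set A B u r; rewrite cA cB cAB muln1.
have k00 : #|comb_set A B 0 0| = 0%N by have := kE 0 0; rewrite eqxx /=; lia.
have k10 : #|comb_set A B 1 0| = s by have := kE 1 0; rewrite eqxx oner_eq0 /=; lia.
have k01 : #|comb_set A B 0 1| = s by have := kE 0 1; rewrite eqxx oner_eq0 /=; lia.
have k11 : #|comb_set A B 1 1| = (2 * s - 2)%N.
  by have := kE 1 1; rewrite oner_eq0 /=; lia.
have wtk u r v := weight_spread_fun (comb_set A B u r) v mt (ltnW (ltnW t3)) spE.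
have C_lin : is_linear_code C by exact: code_fg_linear.
have ker u r v : codeword f g u r v = 0 -> [/\ u = 0, r = 0 & v = 0].
  move=> /eqP; rewrite -wt_eq0 wtE => /eqP w0.
  (* With [k] the size of the index set, [v = 0] gives [k = k * 2 ^ t], so [k = 0] and [u = r = 0];
     a nonzero [v] would give [k >= 2 ^ (m - 1)], which is too large. *)
  move: (wtk u r v); rewrite w0 add0n.
  case: (F2P u) => ->; case: (F2P r) => ->; rewrite ?k00 ?k10 ?k01 ?k11;
    case: (eqVneq v 0) => [-> //|v0]; nia.
have cw_inj := codeword_inj ker.
have cardC : #|C| = (2 ^ (m + 2))%N.
  by rewrite card_imset // !card_prod card_rowF2 card_ord expnD mulnC.
have key u1 r1 v1 u2 r2 v2 :
    (0 < wt (codeword f g u1 r1 v1))%N -> (0 < wt (codeword f g u2 r2 v2))%N ->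
    wt (codeword f g (u1 + u2) (r1 + r2) (v1 + v2)) <>
    (wt (codeword f g u1 r1 v1) + wt (codeword f g u2 r2 v2))%N.
  rewrite !wtE; have k3 := kE (u1 + u2) (r1 + r2); rewrite !F2_neq0D in k3.
  apply: (spread_weight_not_sum T8 _ s2 sT2 (kE u1 r1) (kE u2 r2) k3
            (wtk u1 r1 v1) (wtk u2 r2 v2) (wtk _ _ (v1 + v2))).
  - by rewrite -mT.
  (* If one of [v1], [v2], [v1 + v2] vanishes, the other two coincide. *)
  - by move=> /eqP ->; rewrite add0r.
  - by move=> /eqP ->; rewrite addr0.
  - by rewrite -(rowF2_addK v2) => /eqP/addIr ->.
split.
- split=> //; first exact: codelenE.
  by apply/eqP; rewrite -(@eqn_exp2l 2) // -card_linear_code // cardC.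
- move=> _ _ /imsetP[[[u r] v] _ ->] /imsetP[[[u' r'] v'] _ ->] /= c0 c'0 sub.
  have wD := wt_addK sub.
  case: (eqVneq (codeword f g u r v + codeword f g u' r' v') 0) => [|d0].
    by rewrite -(rowF2_addK (codeword f g u' r' v')) => /addIr.
  rewrite -wt_eq0 -lt0n in c'0; rewrite -wt_eq0 -lt0n -codewordD in d0.
  (* [key] is applied to [c'] and [c + c'], whose sum is [c]. *)
  have := key _ _ _ _ _ _ c'0 d0; rewrite !codewordD addrCA rowF2_addK addr0.
  by case.
- move=> w; rewrite card_wt_code_fg // !sum_F2 listed_multE.
  have cnt u r k : #|comb_set A B u r| = k -> (k <= 2 ^ t)%N ->
      (\sum_v (wt (codeword f g u r v) == w) =
       (k * (2 ^ t - 1) == w)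
       + (2 ^ t + 1 - k) * (2 ^ t - 1) * (2 ^ (m - 1) - k == w)
       + k * (2 ^ t - 1) * (2 ^ (m - 1) + 2 ^ t - k == w))%N.
    move=> <- kT; rewrite -(card_weight_spread_fun w mt (ltnW (ltnW t3)) spE kT).
    by apply: eq_bigr => v _; rewrite wtE.
  have [sle s2le] : (s <= 2 ^ t /\ 2 * s - 2 <= 2 ^ t)%N by split; lia.
  rewrite (cnt 0 0 _ k00) // (cnt 1 0 _ k10) // (cnt 0 1 _ k01) // (cnt 1 1 _ k11) //.
  rewrite !big_cons big_nil /= !mul0n !subn0.
  have -> : (2 ^ t + 1 - (2 * s - 2) = 2 ^ t + 3 - 2 * s)%N by lia.
  have -> : ((2 ^ t + 1) * (2 ^ t - 1) = 2 ^ m - 1)%N.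
    by rewrite mulnBr muln1 mT; move: (2 ^ t)%N T8 => T T8; nia.
  (* Once the eight distinct tests against [w] are generalized and the factor 2 is moved out, both
     sides are linear in the same products. *)
  by rewrite -!(mulnA 2%N); do 8!move: (nat_of_bool (_ == w)) => ?; lia.
- move=> sT4.
  have T4 : (2 ^ t = 4 * 2 ^ (t - 2))%N.
    by rewrite -[4%N]/(2 ^ 2)%N -expnD; congr (2 ^ _)%N; lia.
  (* A sample nonzero vector: its linear word has weight [2 ^ (m - 1)], while the word of [f] has
     weight [s * (2 ^ t - 1)], at most half of that when [s <= 2 ^ (t - 2)]. They bound the extreme
     weights. *)
  pose v : 'rV['F_2]_m := const_mx 1.
  have v0 : v != 0.
    apply/eqP => /rowP/(_ (Ordinal (leq_trans (isT : (0 < 6)%N) m6)))/eqP.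
    by rewrite !mxE oner_eq0.
  have wv : wt (codeword f g 0 0 v) = (2 ^ (m - 1))%N.
    have := wtk 0 0 v; rewrite -wtE k00 addn0 (negPf v0) => ->.
    rewrite (_ : [exists i in _, _] = false) ?mul0n ?addn0 //.
    by apply/existsP => -[i]; rewrite (card0_eq k00).
  have w1 : (wt (codeword f g 1 0 0)%R + s = s * 2 ^ t)%N.
    by have := wtk 1 0 0; rewrite -wtE k10 eqxx.
  have inC u r v1 : codeword f g u r v1 \in C by apply/imsetP; exists (u, r, v1).
  pose P := [pred c | (c \in C) && (c != 0)].
  have c1 : P (codeword f g 1 0 0).
    by rewrite /= inC -wt_eq0; nia.
  have [cmin /andP[minC min0] minP] := arg_minnP (P := P) (fun c => wt c) c1.
  have [cmax /andP[maxC max0] maxP] := arg_maxnP (P := P) (fun c => wt c) c1.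
  exists cmin, cmax; split=> //.
    move=> c cC c0; have Pc : P c by rewrite /= cC.
    by apply/andP; split; [exact: minP | exact: maxP].
  have := minP _ c1; have : (wt (codeword f g 0 0 v)%R <= wt cmax)%N.
    by apply: maxP; rewrite /= inC -wt_eq0 wv -lt0n expn_gt0.
  rewrite wv; move: w1; nia.
Qed.
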